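(* Let $\alpha:I\to\mathbb{E}^4_1$ be a null Cartan curve with Cartan frame $\{T,N,B_1,B_2\}$ and Cartan curvatures $\kappa_2,\kappa_3$, and suppose $\kappa_3\not\equiv 0$. The following are equivalent: (i) $\alpha$ is a null Cartan helix: $\kappa_2$ and $\kappa_3\neq 0$ are both constant on $I$. (ii) There exist real constants $\nu_0\neq 0$, $\mu_0$, $\lambda_0$ with $\mu_0^2+\nu_0^2=1$ satisfying (at every $s\in I$) the algebraic constraints $$\lambda_0=\nu_0\kappa_2,\qquad \kappa_3\Bigl(\frac{\mu_0}{\nu_0}\Bigr)^2+\kappa_2^2\Bigl(\frac{\mu_0}{\nu_0}\Bigr)-\kappa_3=0,$$ and a fixed vector $W\in\mathbb{E}^4_1\setminus\{0\}$ such that $$\langle V,W\rangle=0\quad\text{for all }s\in I,\qquad V:=\lambda_0T+\mu_0N+\nu_0B_1 .$$ Moreover, under either condition there are exactly two unit fields $V_1,V_2$ satisfying (ii) (up to overall sign), corresponding to the two roots $r_1,r_2$ of the quadratic equation $\kappa_3r^2+\kappa_2^2r-\kappa_3=0$ in $r=\mu_0/\nu_0$. They are mutually orthogonal, $\langle V_1,V_2\rangle=0$, and the product of the roots satisfies $r_1r_2=-1$.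
   Context: Minkowski space-time $\mathbb{E}^4_1$ is $\mathbb{R}^4$ with the metric $\langle x,y\rangle=-x_1y_1+x_2y_2+x_3y_3+x_4y_4$. A null Cartan curve is a smooth null curve $\alpha:I\to\mathbb{E}^4_1$ ($I$ an interval, $\alpha'\neq0$, $\langle\alpha',\alpha'\rangle=0$) parametrized by pseudo-arc length $s$ (so $\langle\alpha'',\alpha''\rangle=1$), together with its Cartan frame $\{T,N,B_1,B_2\}$, $T=\alpha'$, $N=\alpha''$, where $\langle T,T\rangle=\langle B_2,B_2\rangle=0$, $\langle N,N\rangle=\langle B_1,B_1\rangle=1$, $\langle T,B_2\rangle=1$, all other inner products of frame vectors vanish, $\det(T,N,B_1,B_2)=1$, and $$T'=N,\quad N'=\kappa_2B_1-B_2,\quad B_1'=\kappa_3T-\kappa_2N,\quad B_2'=-\kappa_3B_1$$ for smooth functions $\kappa_2,\kappa_3:I\to\mathbb{R}$ (the Cartan curvatures). Primes denote $d/ds$. A fixed vector is one that does not depend on $s$. For $V=\lambda_0T+\mu_0N+\nu_0B_1$ one has $\langle V,V\rangle=\mu_0^2+\nu_0^2$, so $V$ is a unit field when $\mu_0^2+\nu_0^2=1$. *)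

(* Defs.v *)
From HB Require Import structures.
From mathcomp Require Import all_boot all_order all_algebra.
From mathcomp Require Import all_classical all_reals all_analysis.

Set Implicit Arguments.
Unset Strict Implicit.
Unset Printing Implicit Defensive.

Import Order.TTheory GRing.Theory Num.Theory.
Import numFieldNormedType.Exports.

Local Open Scope classical_set_scope.
Local Open Scope ring_scope.

Section Calculus.
Context {R : realType} {V : normedModType R}.

(* The derivative is taken within I, hence one-sided at an endpoint of I
   belonging to I; values of f outside I are irrelevant. *)
Definition is_derive_within (I : set R) (f : R -> V) (s : R) (l : V) : Prop :=
  (t - s)^-1 *: (f t - f s) @[t --> within I s^'] --> l.

(* g k is the k-th derivative of f on I. *)
Definition smooth_on (I : set R) (f : R -> V) : Prop :=
  exists g : nat -> R -> V, g 0%N = f /\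
    forall k s, I s -> is_derive_within I (g k) s (g k.+1 s).

End Calculus.

Definition nondegenerate_interval {R : realType} (I : set R) : Prop :=
  is_interval I /\ exists a b, [/\ I a, I b & a < b].

Section Minkowski.
Context {R : realType}.

(* The time-like coordinate comes first. *)
Definition mink (x y : 'rV[R]_4) : R :=
  - (x 0 0 * y 0 0) + x 0 1 * y 0 1 + x 0 2 * y 0 2 + x 0 3 * y 0 3.

Record null_cartan_curve (I : set R) (alpha T N B1 B2 : R -> 'rV[R]_4)
    (k2 k3 : R -> R) : Prop := NullCartanCurve {
  ncc_interval : nondegenerate_interval I;
  ncc_smooth : smooth_on I alpha;
  ncc_smooth_k2 : smooth_on I k2;
  ncc_smooth_k3 : smooth_on I k3;
  ncc_tangent : forall s, I s -> is_derive_within I alpha s (T s);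
  ncc_T_neq0 : forall s, I s -> T s != 0;
  ncc_TT : forall s, I s -> mink (T s) (T s) = 0;
  (* Since N is the second derivative of alpha, this is also the condition
     that s is the pseudo-arc length parameter. *)
  ncc_NN : forall s, I s -> mink (N s) (N s) = 1;
  ncc_B1B1 : forall s, I s -> mink (B1 s) (B1 s) = 1;
  ncc_B2B2 : forall s, I s -> mink (B2 s) (B2 s) = 0;
  ncc_TB2 : forall s, I s -> mink (T s) (B2 s) = 1;
  ncc_TN : forall s, I s -> mink (T s) (N s) = 0;
  ncc_TB1 : forall s, I s -> mink (T s) (B1 s) = 0;
  ncc_NB1 : forall s, I s -> mink (N s) (B1 s) = 0;
  ncc_NB2 : forall s, I s -> mink (N s) (B2 s) = 0;
  ncc_B1B2 : forall s, I s -> mink (B1 s) (B2 s) = 0;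
  ncc_det : forall s, I s ->
    \det (\matrix_(i < 4) nth 0 [:: T s; N s; B1 s; B2 s] i) = 1;
  ncc_dT : forall s, I s -> is_derive_within I T s (N s);
  ncc_dN : forall s, I s -> is_derive_within I N s (k2 s *: B1 s - B2 s);
  ncc_dB1 : forall s, I s ->
    is_derive_within I B1 s (k3 s *: T s - k2 s *: N s);
  ncc_dB2 : forall s, I s -> is_derive_within I B2 s (- k3 s *: B1 s)
}.

Definition null_cartan_helix (I : set R) (k2 k3 : R -> R) : Prop :=
  exists c2 c3 : R, c3 != 0 /\ forall s, I s -> k2 s = c2 /\ k3 s = c3.

Definition frame_field (T N B1 : R -> 'rV[R]_4) (lambda0 mu0 nu0 : R)
    (s : R) : 'rV[R]_4 :=
  lambda0 *: T s + mu0 *: N s + nu0 *: B1 s.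

Definition curvature_quadratic (k2 k3 : R -> R) (s r : R) : R :=
  k3 s * r ^+ 2 + k2 s ^+ 2 * r - k3 s.

Definition unit_axis_field (I : set R) (T N B1 : R -> 'rV[R]_4)
    (k2 k3 : R -> R) (lambda0 mu0 nu0 : R) : Prop :=
  [/\ nu0 != 0,
      mu0 ^+ 2 + nu0 ^+ 2 = 1,
      forall s, I s -> lambda0 = nu0 * k2 s,
      forall s, I s -> curvature_quadratic k2 k3 s (mu0 / nu0) = 0 &
      exists2 W : 'rV[R]_4, W != 0 &
        forall s, I s -> mink (frame_field T N B1 lambda0 mu0 nu0 s) W = 0].

Definition eq_up_to_sign (I : set R) (V V' : R -> 'rV[R]_4) : Prop :=
  (forall s, I s -> V s = V' s) \/ (forall s, I s -> V s = - V' s).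

End Minkowski.

(* Main.v *)
Require Import Defs.
From HB Require Import structures.
From mathcomp Require Import all_boot all_order all_algebra.
From mathcomp Require Import all_classical all_reals all_analysis.
From mathcomp Require Import ring lra.

Set Implicit Arguments.
Unset Strict Implicit.
Unset Printing Implicit Defensive.

Import Order.TTheory GRing.Theory Num.Theory.
Import numFieldNormedType.Exports.

Local Open Scope classical_set_scope.
Local Open Scope ring_scope.

(** Suppose first that the curvatures are constant, with k3 nonzero, and let
    V = lambda0 T + mu0 N + nu0 B1 satisfy the two constraints.  Scaling to
    nu0 = 1, the constraint lambda0 = k2 gives V = k2 T + r N + B1, with r a
    root of Q(r) = k3 r^2 + k2^2 r - k3.  The Cartan equations give
      V' = k3 T + r k2 B1 - r B2,    V'' = r k3 V - Q(r) N,
    so that V'' = r k3 V, and V, V' span a plane that does not move.  The same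
    holds for the other root q.  Since the product of the roots is -1, the field
    V_q is orthogonal to V_r; the frame products show that V_q' is, too.  The
    fixed plane of V_q thus lies in the hyperplane orthogonal to V_r for every
    s, and any nonzero vector of that plane, such as V_q' at one parameter, is
    an admissible W ([helix_fixed_vector]).  That the plane does not move is
    used in the form of the constancy of the bivector V_q' /\ V_q, evaluated at
    two arbitrary vectors ([helix_axis_bivector_cst]); this avoids solving the
    differential equation V'' = q k3 V.

    Conversely, lambda0 = nu0 k2 makes k2 constant, and the quadratic
    constraint k3 (r^2 - 1) = - k2^2 r makes k3 constant unless r^2 = 1.  When
    r^2 = 1, it only says that k2 = 0, and k3 has to be controlled by the fixed
    vector W: successive derivatives of <V, W> = 0 show that k3' annihilates the
    four products of W with the frame, hence k3' = 0 because W is not zero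
    ([orthogonal_fixed_vector_k3_cst]).

    A unit field is determined up to sign by r, as nu0^2 (1 + r^2) = 1
    ([unit_axis_field_unique]), and <V_1, V_2> = nu1 nu2 (r1 r2 + 1) = 0. *)

(** * Derivatives within an interval *)

Section DeriveWithin.
Context {R : realType} (I : set R).

Lemma near_eq_cvg_to {U : topologicalType} {F : set_system R} {FF : Filter F}
    (f g : R -> U) (l : U) :
  (\forall t \near F, f t = g t) ->
  f t @[t --> F] --> l -> g t @[t --> F] --> l.
Proof. by move=> /near_eq_cvg fg fl P Pl; apply: fg; exact: fl. Qed.

Lemma within_dnbhs_neq (s : R) : \forall t \near within I s^', I t /\ t != s.
Proof.
rewrite /dnbhs !near_withinE; apply: nearW => t ts It; split => //.
Qed.

(** Limits within the interval are unique, at its endpoints too: some u <> s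
    lies in the interval, and so does the segment from s to u. *)
Lemma nondegenerate_within_proper (s : R) :
  nondegenerate_interval I -> I s -> ProperFilter (within I s^').
Proof.
move=> [Iitv [a [b [Ia Ib ltab]]]] Is; split; last exact: within_filter.
case=> e /= e0 se.
have [u Iu us] : exists2 u, I u & u != s.
  by have [<-|] := eqVneq a s; [exists b; rewrite ?gt_eqF|exists a].
(* A point at distance d from s on the side of u lies in the ball and in I. *)
pose d := Num.min (e / 2) `|u - s|.
have d0 : 0 < d by rewrite lt_min divr_gt0 //= normr_gt0 subr_eq0.
have de : d < e by rewrite gt_min; apply/orP; left; lra.
have dle : d <= `|u - s| by rewrite ge_min lexx orbT.
have [su|su] := ltP s u.
- apply: (se (s + d)); rewrite /=.
  + by rewrite opprD addrA subrr sub0r normrN gtr0_norm.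
  + by rewrite gt_eqF // ltrDl.
  + apply: (Iitv s u) => //; rewrite lerDl ltW //=.
    by move: dle; rewrite gtr0_norm ?subr_gt0 //; lra.
- apply: (se (s - d)).
  + by rewrite /= opprB addrC subrK gtr0_norm.
  + by rewrite lt_eqF // ltrBlDr ltrDl.
  + apply: (Iitv u s) => //; rewrite andbC gerBl ltW //=.
    by move: dle; rewrite ler0_norm ?subr_le0 //; lra.
Qed.

Section Rules.
Context {V : normedModType R}.
Implicit Types (f g : R -> V) (k : R -> R) (s : R).

Lemma is_derive_within_unique f s l l' : nondegenerate_interval I -> I s ->
  is_derive_within I f s l -> is_derive_within I f s l' -> l = l'.
Proof.
move=> Iitv Is fl fl'; have FF := nondegenerate_within_proper Iitv Is.
exact: (cvg_unique (@norm_hausdorff _ V) fl fl').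
Qed.

Lemma eq_is_derive_within f g s l : (forall t, I t -> f t = g t) -> I s ->
  is_derive_within I f s l -> is_derive_within I g s l.
Proof.
move=> fg Is fl; apply: near_eq_cvg_to fl.
by apply: filterS (within_dnbhs_neq s) => t [It _]; rewrite !fg.
Qed.

Lemma is_derive_within_cst (v : V) s : is_derive_within I (fun=> v) s 0.
Proof.
rewrite /is_derive_within subrr; under eq_fun do rewrite scaler0.
exact: cvg_cst.
Qed.

Lemma is_derive_within_continuous f s l :
  is_derive_within I f s l -> f t @[t --> within I s^'] --> f s.
Proof.
move=> fl; apply/subr_cvg0.
have ts : (t - s) @[t --> within I s^'] --> (0 : R).
  apply/subr_cvg0; apply: cvg_trans (@nbhs_dnbhs _ s).
  exact: cvg_within.
rewrite -(scale0r l); apply: near_eq_cvg_to (cvgZ ts fl).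
apply: filterS (within_dnbhs_neq s) => t [_ ts'].
by rewrite scalerA divff ?subr_eq0// scale1r.
Qed.

Lemma is_derive_withinD f g s l m :
  is_derive_within I f s l -> is_derive_within I g s m ->
  is_derive_within I (fun t => f t + g t) s (l + m).
Proof.
move=> fl gm; apply: near_eq_cvg_to (cvgD fl gm).
by near=> t; rewrite /= -scalerDr opprD addrACA.
Unshelve. all: by end_near. Qed.

Lemma is_derive_withinZ k f s a l :
  is_derive_within I k s a -> is_derive_within I f s l ->
  is_derive_within I (fun t => k t *: f t) s (a *: f s + k s *: l).
Proof.
move=> ka fl.
apply: near_eq_cvg_to (cvgD (cvgZ ka (is_derive_within_continuous fl))
                            (cvgZ (cvg_cst (k s)) fl)).
near=> t.
rewrite /= -[_ *: (k t - k s)]/(_ * _) !scalerA [k s * _]mulrC -!scalerA.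
rewrite -scalerDr.
by rewrite scalerBl scalerBr addrA subrK.
Unshelve. all: by end_near. Qed.

End Rules.

Lemma is_derive_within_interior (f : R -> R) s a :
  I° s -> is_derive_within I f s a -> is_derive s 1 f a.
Proof.
move=> Is fa; apply/is_derive1_caratheodory.
exists (fun t => if t == s then a else (f t - f s) / (t - s)); split.
- move=> t; case: eqVneq => [->|ts]; first by rewrite !subrr mulr0.
  by rewrite divfK ?subr_eq0.
- apply/continuous_withinNx; rewrite eqxx.
  have -> : s^' = within I s^'.
    rewrite eqEsubset; split => P; last first.
      by apply: filterS2 Is => t It H ts; exact: H.
    by apply: filterS => t Pt _.
  apply: near_eq_cvg_to fa.
  apply: filterS (within_dnbhs_neq s) => t [_ /negbTE ->].
  by rewrite /GRing.scale /= mulrC.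
- by rewrite eqxx.
Qed.

Lemma cvg_within_nbhs (J : set R) (f : R -> R) (s : R) : J `<=` I ->
  f t @[t --> within I s^'] --> f s -> f t @[t --> within J (nbhs s)] --> f s.
Proof.
move=> JI fs P Pfs.
have fP : \forall t \near s^', I t -> P (f t) by exact: (fs P Pfs).
suff : \forall t \near s, J t -> P (f t) by [].
move: fP; rewrite near_withinE; apply: filterS => t H Jt.
have [->|ts] := eqVneq t s; first exact: nbhs_singleton Pfs.
by apply: H => //; exact: JI.
Qed.

(** The mean value theorem needs two-sided derivatives only at interior points;
    at the ends of a segment, continuity within the interval suffices. *)
Lemma is_derive_within0_cst (f : R -> R) : is_interval I ->
  (forall s, I s -> is_derive_within I f s 0) ->
  forall s t, I s -> I t -> f s = f t.
Proof.
move=> Iitv f0.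
suff H s t : I s -> I t -> s < t -> f s = f t.
  by move=> s t Is It; have [/H->|/H->|->] := ltgtP s t.
move=> Is It st.
have sub x : s <= x <= t -> I x by exact: Iitv.
have df x : x \in `]s, t[ -> is_derive x 1 f 0.
  move=> xst; apply: is_derive_within_interior; last first.
    by apply/f0/sub; move: xst; rewrite in_itv /= => /andP[/ltW-> /ltW->].
  apply: filterS (near_in_itvoo xst) => y; rewrite in_itv /= => /andP[sy yt].
  by apply: sub; rewrite !ltW.
have cf : {within `[s, t], continuous f}.
  apply/subspace_continuousP => x /= xst.
  have Ix : I x by apply: sub; move: xst; rewrite in_itv.
  apply: cvg_within_nbhs (is_derive_within_continuous (f0 x Ix)).
  by move=> y /= yst; apply: sub; move: yst; rewrite in_itv.
have [c _] := MVT st df cf.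
by rewrite mul0r => /eqP; rewrite subr_eq0 => /eqP.
Qed.

End DeriveWithin.

(** * The Minkowski product *)

Section MinkowskiForm.
Context {R : realType}.
Implicit Types (x y z : 'rV[R]_4) (a : R).

Lemma minkC x y : mink x y = mink y x.
Proof. by rewrite /mink; ring. Qed.

Lemma minkDl x y z : mink (x + y) z = mink x z + mink y z.
Proof. by rewrite /mink !mxE; ring. Qed.

Lemma minkZl a x z : mink (a *: x) z = a * mink x z.
Proof. by rewrite /mink !mxE; ring. Qed.

Lemma minkNl x z : mink (- x) z = - mink x z.
Proof. by rewrite -scaleN1r minkZl mulN1r. Qed.

Lemma minkDr x y z : mink z (x + y) = mink z x + mink z y.
Proof. by rewrite minkC minkDl !(minkC _ z). Qed.

Lemma minkZr a x z : mink z (a *: x) = a * mink z x.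
Proof. by rewrite minkC minkZl (minkC x). Qed.

Lemma minkNr x z : mink z (- x) = - mink z x.
Proof. by rewrite minkC minkNl (minkC x). Qed.

Definition minkE := (minkDl, minkDr, minkNl, minkNr, minkZl, minkZr).

Lemma mink0r x : mink x 0 = 0.
Proof. by rewrite -(scale0r 0) minkZr mul0r. Qed.

Lemma mink_continuous z : continuous (fun x => mink x z).
Proof.
move=> x.
have c j : (fun y : 'rV[R]_4 => y 0 j * z 0 j) y @[y --> x] -->
    x 0 j * z 0 j.
  have cj : (fun y : 'rV[R]_4 => y 0 j) y @[y --> x] --> x 0 j.
    exact: coord_continuous.
  exact: cvgM cj (cvg_cst _).
exact: (cvgD (cvgD (cvgD (cvgN (c 0)) (c 1)) (c 2)) (c 3)).
Qed.

Lemma is_derive_within_mink (I : set R) (f : R -> 'rV[R]_4) s l z :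
  is_derive_within I f s l ->
  is_derive_within I (fun t => mink (f t) z) s (mink l z).
Proof.
move=> fl.
have : mink ((t - s)^-1 *: (f t - f s)) z @[t --> within I s^'] --> mink l z.
  exact: (@cvg_comp _ _ _ (fun t => (t - s)^-1 *: (f t - f s))
    (fun x => mink x z) _ _ _ fl (@mink_continuous z l)).
by apply: near_eq_cvg_to; apply: nearW => t; rewrite /= minkZl minkDl minkNl.
Qed.

(** The Minkowski product with W is the Euclidean product with W whose time
    coordinate is negated, so the hypothesis is a linear system with an
    invertible matrix. *)
Lemma mink_det_eq0 (e : seq 'rV[R]_4) (W : 'rV[R]_4) :
  \det (\matrix_(i < 4) nth 0 e i) != 0 ->
  (forall i : 'I_4, mink (nth 0 e i) W = 0) -> W = 0.
Proof.
move=> De eW.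
pose w : 'cV[R]_4 := \col_i (if i == 0 then - W 0 i else W 0 i).
have /(congr1 (mulmx (invmx (\matrix_(i < 4) nth 0 e i)))) :
    (\matrix_(i < 4) nth 0 e i) *m w = 0.
  apply/colP => i; rewrite !mxE -[RHS](eW i) /mink !big_ord_recr big_ord0 /=.
  rewrite !mxE add0r /=.
  have -> : widen_ord (leqnSn 3)
      (widen_ord (leqnSn 2) (widen_ord (leqnSn 1) ord_max)) = 0 :> 'I_4.
    exact: val_inj.
  have -> : widen_ord (leqnSn 3) (widen_ord (leqnSn 2) ord_max) = 1 :> 'I_4.
    exact: val_inj.
  have -> : widen_ord (leqnSn 3) ord_max = 2 :> 'I_4 by exact: val_inj.
  have -> : ord_max = 3 :> 'I_4 by exact: val_inj.
  by rewrite /= mulrN.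
rewrite mulmx0 mulKmx ?unitmxE ?unitfE // => w0.
apply/rowP => j; have /colP/(_ j) := w0; rewrite !mxE.
by case: ifP => // _ /eqP; rewrite oppr_eq0 => /eqP.
Qed.

End MinkowskiForm.

(** * Null Cartan curves *)

Section NullCartanCurve.
Context {R : realType} {I : set R} {alpha T N B1 B2 : R -> 'rV[R]_4}.
Context {k2 k3 : R -> R}.
Hypothesis Hcurve : null_cartan_curve I alpha T N B1 B2 k2 k3.

Let Iitv := ncc_interval Hcurve.

Lemma curve_domain_nonempty : exists s, I s.
Proof. by case: Iitv => _ [a [b [Ia _ _]]]; exists a. Qed.

Lemma eq_on_is_derive_within (f g : R -> R) s a b : I s ->
  (forall t, I t -> f t = g t) ->
  is_derive_within I f s a -> is_derive_within I g s b -> a = b.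
Proof.
move=> Is fg fa gb.
exact: is_derive_within_unique Iitv Is (eq_is_derive_within fg Is fa) gb.
Qed.

Lemma frame_nondegenerate s (W : 'rV[R]_4) : I s ->
  mink (T s) W = 0 -> mink (N s) W = 0 -> mink (B1 s) W = 0 ->
  mink (B2 s) W = 0 -> W = 0.
Proof.
move=> Is tW nW bW cW; apply: (@mink_det_eq0 _ [:: T s; N s; B1 s; B2 s]).
  by rewrite (ncc_det Hcurve Is) oner_neq0.
by case=> [[|[|[|[|//]]]] ?].
Qed.

Lemma mink_frame s : I s ->
  (mink (T s) (T s) = 0) * (mink (N s) (N s) = 1) * (mink (B1 s) (B1 s) = 1) *
  (mink (B2 s) (B2 s) = 0) *
  (mink (T s) (N s) = 0) * (mink (N s) (T s) = 0) *
  (mink (T s) (B1 s) = 0) * (mink (B1 s) (T s) = 0) *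
  (mink (T s) (B2 s) = 1) * (mink (B2 s) (T s) = 1) *
  (mink (N s) (B1 s) = 0) * (mink (B1 s) (N s) = 0) *
  (mink (N s) (B2 s) = 0) * (mink (B2 s) (N s) = 0) *
  (mink (B1 s) (B2 s) = 0) * (mink (B2 s) (B1 s) = 0).
Proof.
move=> Is; case: Hcurve => _ _ _ _ _ _ H1 H2 H3 H4 H5 H6 H7 H8 H9 H10 _ _ _ _ _.
rewrite ![mink (N s) (T s)]minkC ![mink (B1 s) (T s)]minkC.
rewrite ![mink (B2 s) (T s)]minkC ![mink (B1 s) (N s)]minkC.
rewrite ![mink (B2 s) (N s)]minkC ![mink (B2 s) (B1 s)]minkC.
by do ![split]; auto.
Qed.

Section FixedVector.
Variable W : 'rV[R]_4.
Let t s := mink (T s) W.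
Let n s := mink (N s) W.
Let b s := mink (B1 s) W.
Let c s := mink (B2 s) W.

Lemma is_derive_within_mink_T s : I s -> is_derive_within I t s (n s).
Proof. by move=> Is; exact/is_derive_within_mink/(ncc_dT Hcurve). Qed.

Lemma is_derive_within_mink_N s : I s ->
  is_derive_within I n s (k2 s * b s - c s).
Proof.
move=> Is; have := is_derive_within_mink (z := W) (ncc_dN Hcurve Is).
by rewrite minkDl minkNl minkZl.
Qed.

Lemma is_derive_within_mink_B1 s : I s ->
  is_derive_within I b s (k3 s * t s - k2 s * n s).
Proof.
move=> Is; have := is_derive_within_mink (z := W) (ncc_dB1 Hcurve Is).
by rewrite minkDl minkNl !minkZl.
Qed.

Lemma is_derive_within_mink_B2 s : I s ->
  is_derive_within I c s (- (k3 s * b s)).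
Proof.
move=> Is; have := is_derive_within_mink (z := W) (ncc_dB2 Hcurve Is).
by rewrite minkZl mulNr.
Qed.

(** This is the case where the quadratic constraint leaves k3 free.  With
    k2 = 0, differentiating r n + b = 0 gives c = r k3 t; differentiating that,
    and using c' = - k3 b = r k3 n, leaves k3' t = 0.  One more derivative,
    multiplied by k3', gives k3' n = 0, and b and c are multiples of n and t. *)
Lemma orthogonal_fixed_vector_k3_cst (r : R) : r ^+ 2 = 1 -> W != 0 ->
  (forall s, I s -> k2 s = 0) -> (forall s, I s -> r * n s + b s = 0) ->
  forall s s', I s -> I s' -> k3 s = k3 s'.
Proof.
move=> r2 W0 k20 Vorth.
have [g [g0 dg]] := ncc_smooth_k3 Hcurve.
have dk3 s : I s -> is_derive_within I k3 s (g 1 s).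
  by move=> Is; have := dg 0%N s Is; rewrite g0.
have bE s : I s -> b s = - r * n s.
  by move=> /Vorth/eqP; rewrite addrC addr_eq0 mulNr => /eqP.
have cE s : I s -> c s = r * (k3 s * t s).
  move=> Is.
  have := eq_on_is_derive_within Is bE (is_derive_within_mink_B1 Is)
    (is_derive_withinZ (is_derive_within_cst I (- r) s)
      (is_derive_within_mink_N Is)).
  rewrite k20 // /GRing.scale /= => E.
  have -> : k3 s * t s = r * c s by move: E; rewrite !mul0r => E; lra.
  by rewrite mulrA -expr2 r2 mul1r.
have g1t s : I s -> g 1 s * t s = 0.
  move=> Is.
  have := eq_on_is_derive_within Is cE (is_derive_within_mink_B2 Is)
    (is_derive_withinZ (is_derive_within_cst I r s)
      (is_derive_withinZ (dk3 s Is) (is_derive_within_mink_T Is))).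
  rewrite bE // /GRing.scale /= => E.
  have {}E : r * (g 1 s * t s) = 0 by move: E; rewrite mul0r => E; lra.
  by rewrite -[LHS]mul1r -r2 expr2 -mulrA E mulr0.
have g1n s : I s -> g 1 s * n s = 0.
  move=> Is.
  have E : g 2 s * t s + g 1 s * n s = 0.
    exact: (eq_on_is_derive_within Is g1t
      (is_derive_withinZ (dg 1%N s Is) (is_derive_within_mink_T Is))
      (is_derive_within_cst I (0 : R) s)).
  have {}E : g 1 s * (g 1 s * n s) = 0.
    transitivity (g 1 s * (g 2 s * t s + g 1 s * n s) - g 2 s * (g 1 s * t s)).
      by ring.
    by rewrite E g1t // !mulr0 subrr.
  move/eqP: E; rewrite mulf_eq0 => /orP[/eqP->|/eqP//]; exact: mul0r.
apply: is_derive_within0_cst; first by case: Iitv.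
move=> s Is; have := dk3 s Is; suff -> : g 1 s = 0 by [].
apply/eqP; apply: contraNT W0 => g1N0; apply/eqP.
have t0 : t s = 0.
  by move/eqP: (g1t s Is); rewrite mulf_eq0 (negbTE g1N0) => /eqP.
have n0 : n s = 0.
  by move/eqP: (g1n s Is); rewrite mulf_eq0 (negbTE g1N0) => /eqP.
apply: (frame_nondegenerate Is t0 n0); first by rewrite -/(b s) bE // n0 mulr0.
by rewrite -/(c s) cE // t0 !mulr0.
Qed.

End FixedVector.

Lemma unit_axis_field_helix (lambda0 mu0 nu0 : R) :
  (exists s, I s /\ k3 s != 0) ->
  unit_axis_field I T N B1 k2 k3 lambda0 mu0 nu0 -> null_cartan_helix I k2 k3.
Proof.
move=> [s0 [Is0 k3s0]] [nu0N0 _ lamE quad [W W0 Vorth]].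
exists (k2 s0), (k3 s0); split=> // s Is.
have k2E u : I u -> k2 u = k2 s0.
  by move=> Iu; apply: (mulfI nu0N0); rewrite -!lamE.
split; first exact: k2E.
set r := mu0 / nu0 in quad.
have quadE u : I u -> k3 u * (r ^+ 2 - 1) = - (k2 s0 ^+ 2 * r).
  move=> Iu; have := quad u Iu.
  by rewrite /curvature_quadratic (k2E u Iu) => E; lra.
have [r21|r2N1] := eqVneq (r ^+ 2) 1; last first.
  by apply: (mulIf (_ : r ^+ 2 - 1 != 0)); rewrite ?subr_eq0 // !quadE.
have k20 u : I u -> k2 u = 0.
  move=> Iu; rewrite k2E //; apply/eqP; rewrite -sqrf_eq0.
  have /eqP := quadE s0 Is0; rewrite r21 subrr mulr0 eq_sym oppr_eq0 mulf_eq0.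
  case/orP => // /eqP r0; move/eqP: r21.
  by rewrite r0 expr0n eq_sym oner_eq0.
apply: (orthogonal_fixed_vector_k3_cst r21 W0 k20) Is Is0 => u Iu.
apply: (mulfI nu0N0); rewrite mulr0 -[RHS](Vorth u Iu) /frame_field.
rewrite !minkDl !minkZl (lamE u Iu) k20 // mulr0 mul0r add0r mulrDr mulrA.
by rewrite [nu0 * r]mulrC divfK.
Qed.

(** * Helices *)

Section Helix.
Variables c2 c3 : R.
Hypotheses (k2E : forall s, I s -> k2 s = c2)
  (k3E : forall s, I s -> k3 s = c3).

(** The direction of the unit field with ratio mu0 / nu0 = r, normalized to
    nu0 = 1, and its derivative in a helix. *)
Let axis r s := c2 *: T s + r *: N s + B1 s.
Let daxis r s := c3 *: T s + (r * c2) *: B1 s - r *: B2 s.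

Lemma is_derive_within_axis q y s : I s ->
  is_derive_within I (fun u => mink (axis q u) y) s (mink (daxis q s) y).
Proof.
move=> Is.
have dV := is_derive_withinD (is_derive_withinD
  (is_derive_withinZ (is_derive_within_cst I c2 s)
    (is_derive_within_mink_T (W := y) Is))
  (is_derive_withinZ (is_derive_within_cst I q s)
    (is_derive_within_mink_N (W := y) Is)))
  (is_derive_within_mink_B1 (W := y) Is).
have -> : (fun u => mink (axis q u) y) =
    (fun u => c2 *: mink (T u) y + q *: mink (N u) y + mink (B1 u) y).
  by apply/funext => u; rewrite /axis !minkE.
congr (is_derive_within _ _ _ _): dV.
by rewrite /daxis !minkE /GRing.scale /= (k2E Is) (k3E Is); ring.
Qed.

(** The field satisfies V'' = q k3 V: the two sides differ by a multiple of N,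
    whose coefficient is minus the value at q of the curvature quadratic. *)
Lemma is_derive_within_axis' q y s : c3 * q ^+ 2 + c2 ^+ 2 * q - c3 = 0 ->
  I s ->
  is_derive_within I (fun u => mink (daxis q u) y) s
    (q * c3 * mink (axis q s) y).
Proof.
move=> qroot Is.
have dD := is_derive_withinD (is_derive_withinD
  (is_derive_withinZ (is_derive_within_cst I c3 s)
    (is_derive_within_mink_T (W := y) Is))
  (is_derive_withinZ (is_derive_within_cst I (q * c2) s)
    (is_derive_within_mink_B1 (W := y) Is)))
  (is_derive_withinZ (is_derive_within_cst I (- q) s)
    (is_derive_within_mink_B2 (W := y) Is)).
have -> : (fun u => mink (daxis q u) y) =
    (fun u => c3 *: mink (T u) y + (q * c2) *: mink (B1 u) y
              + (- q) *: mink (B2 u) y).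
  by apply/funext => u; rewrite /daxis !minkE /GRing.scale /= mulNr.
congr (is_derive_within _ _ _ _): dD.
rewrite /axis !minkE /GRing.scale /= (k2E Is) (k3E Is).
apply/eqP; rewrite -subr_eq0; apply/eqP.
transitivity (- (c3 * q ^+ 2 + c2 ^+ 2 * q - c3) * mink (N s) y); last first.
  by rewrite qroot oppr0 mul0r.
by ring.
Qed.

(** As V'' is a multiple of V, the bivector V' /\ V has derivative
    V'' /\ V + V' /\ V' = 0. *)
Lemma helix_axis_bivector_cst q x y s s0 :
  c3 * q ^+ 2 + c2 ^+ 2 * q - c3 = 0 -> I s -> I s0 ->
  mink (daxis q s) x * mink (axis q s) y
    - mink (axis q s) x * mink (daxis q s) y =
  mink (daxis q s0) x * mink (axis q s0) y
    - mink (axis q s0) x * mink (daxis q s0) y.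
Proof.
move=> qroot Is Is0.
pose omega u :=
  mink (daxis q u) x * mink (axis q u) y
    - mink (axis q u) x * mink (daxis q u) y.
apply: (is_derive_within0_cst (f := omega) _ _ Is Is0); first by case: Iitv.
move=> u Iu.
pose dV z := is_derive_within_axis (q := q) (y := z) Iu.
pose dD z := is_derive_within_axis' (y := z) qroot Iu.
have := is_derive_withinD (is_derive_withinZ (dD x) (dV y))
  (is_derive_withinZ (is_derive_within_cst I (- 1 : R) u)
    (is_derive_withinZ (dV x) (dD y))).
set l := (X in is_derive_within _ _ _ X).
have -> : l = 0 by rewrite /l /GRing.scale /=; ring.
by apply: eq_is_derive_within => // v _; rewrite scaleN1r.
Qed.

(** The bivector of V_q, evaluated at V_q(s0) and V_r(s), vanishes at s because
    V_r(s) is orthogonal to V_q(s) and V_q'(s).  At s0 it is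
    - <V_q, V_q> <V_q'(s0), V_r(s)>, because V_q' is orthogonal to V_q; and
    <V_q, V_q> = 1 + q^2 is positive. *)
Lemma helix_fixed_vector r q s0 : r * q = -1 -> I s0 ->
  c3 * q ^+ 2 + c2 ^+ 2 * q - c3 = 0 ->
  daxis q s0 != 0 /\ forall s, I s -> mink (axis r s) (daxis q s0) = 0.
Proof.
move=> rq Is0 qroot; split.
  have qN0 : q != 0.
    by apply: contra_eqN rq => /eqP ->; rewrite mulr0 eq_sym oppr_eq0 oner_eq0.
  (* The product of V_q' with T is - q. *)
  apply: contraNneq qN0 => D0; have := mink0r (T s0); rewrite -D0 /daxis !minkE.
  by rewrite !(mink_frame Is0) => E; apply/eqP; lra.
move=> s Is.
have E := helix_axis_bivector_cst (axis q s0) (axis r s) qroot Is Is0.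
have VV : mink (axis q s) (axis r s) = 0.
  by rewrite /axis !minkE !(mink_frame Is); lra.
have DV : mink (daxis q s) (axis r s) = 0.
  by rewrite /axis /daxis !minkE !(mink_frame Is); lra.
have DV0 : mink (daxis q s0) (axis q s0) = 0.
  by rewrite /axis /daxis !minkE !(mink_frame Is0); lra.
have VV0 : mink (axis q s0) (axis q s0) = 1 + q ^+ 2.
  by rewrite /axis !minkE !(mink_frame Is0); ring.
move: E; rewrite VV DV DV0 VV0 !mulr0 mul0r subrr sub0r => /esym/eqP.
rewrite oppr_eq0 mulf_eq0 => /orP[|/eqP]; last by rewrite minkC.
by rewrite gt_eqF // ltr_pwDl // sqr_ge0.
Qed.

Lemma helix_unit_axis_field r q nu : r * q = -1 ->
  c3 * r ^+ 2 + c2 ^+ 2 * r - c3 = 0 -> c3 * q ^+ 2 + c2 ^+ 2 * q - c3 = 0 ->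
  nu ^+ 2 * (1 + r ^+ 2) = 1 ->
  unit_axis_field I T N B1 k2 k3 (nu * c2) (r * nu) nu.
Proof.
move=> rq rroot qroot nuE.
have nuN0 : nu != 0.
  by apply: contra_eqN nuE => /eqP ->; rewrite expr0n mul0r eq_sym oner_eq0.
split=> //.
- by rewrite -nuE; ring.
- by move=> s Is; rewrite k2E.
- by move=> s Is; rewrite mulfK // /curvature_quadratic k2E // k3E.
have [s0 Is0] := curve_domain_nonempty.
have [DN0 orth] := helix_fixed_vector rq Is0 qroot.
exists (daxis q s0) => // s Is.
suff -> : frame_field T N B1 (nu * c2) (r * nu) nu s = nu *: axis r s.
  by rewrite minkZl orth // mulr0.
by rewrite /frame_field /axis !scalerDr !scalerA [r * nu]mulrC.
Qed.

End Helix.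

Lemma mink_frame_field l m n l' m' n' s : I s ->
  mink (frame_field T N B1 l m n s) (frame_field T N B1 l' m' n' s) =
  m * m' + n * n'.
Proof.
move=> Is; rewrite /frame_field !minkE.
by rewrite !(mink_frame Is); ring.
Qed.

(** The ratio r = m / n fixes n up to sign by n^2 (1 + r^2) = 1; then m = r n
    and l = n k2 follow. *)
Lemma unit_axis_field_unique l m n l' m' n' :
  unit_axis_field I T N B1 k2 k3 l m n ->
  unit_axis_field I T N B1 k2 k3 l' m' n' -> m / n = m' / n' ->
  eq_up_to_sign I (frame_field T N B1 l m n) (frame_field T N B1 l' m' n').
Proof.
move=> [nN0 mn1 lE _ _] [n'N0 mn1' lE' _ _] rE.
have mE : m = m / n * n by rewrite divfK.
have m'E : m' = m / n * n' by rewrite rE divfK.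
set r := m / n in mE m'E.
have nn' : n ^+ 2 = n' ^+ 2.
  have r0 : 1 + r ^+ 2 != 0 by rewrite gt_eqF // ltr_pwDl // sqr_ge0.
  apply: (mulIf r0); transitivity (1 : R).
    by rewrite -[RHS]mn1 mE; ring.
  by rewrite -[LHS]mn1' m'E; ring.
move/eqP: nn'; rewrite eqf_sqr => /orP[]/eqP nE; [left|right] => s Is;
  rewrite /frame_field (lE s Is) (lE' s Is) mE m'E nE // !mulrN !mulNr !scaleNr.
by rewrite -!opprD.
Qed.

End NullCartanCurve.

Lemma quadratic_roots_product_m1 (R : rcfType) (c p : R) : c != 0 ->
  exists r1 r2 : R, [/\ r1 != r2, r1 * r2 = -1 &
    forall r, c * r ^+ 2 + p * r - c = 0 <-> r = r1 \/ r = r2].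
Proof.
move=> cN0; pose D := p ^+ 2 + 4 * c ^+ 2; pose d := Num.sqrt D.
have D0 : 0 < D.
  by rewrite ltr_wpDl ?sqr_ge0 // mulr_gt0 // lt_def sqrf_eq0 cN0 sqr_ge0.
have d0 : 0 < d by rewrite sqrtr_gt0.
have dE : d ^+ 2 = p ^+ 2 + 4 * c ^+ 2 by rewrite sqr_sqrtr // ltW.
exists ((- p + d) / (2 * c)), ((- p - d) / (2 * c)).
have prod : (- p + d) / (2 * c) * ((- p - d) / (2 * c)) = -1.
  apply: (@mulIf _ (4 * c ^+ 2)).
    by rewrite mulf_neq0 ?sqrf_eq0 // pnatr_eq0.
  by transitivity (p ^+ 2 - d ^+ 2); [field|rewrite dE; ring].
split=> //.
- rewrite -subr_eq0.
  have -> : (- p + d) / (2 * c) - (- p - d) / (2 * c) = d / c by field.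
  by rewrite mulf_neq0 ?invr_eq0 // gt_eqF.
move=> r.
have -> : c * r ^+ 2 + p * r - c =
    c * ((r - (- p + d) / (2 * c)) * (r - (- p - d) / (2 * c))).
  transitivity (c * r ^+ 2 + p * r
    + c * ((- p + d) / (2 * c) * ((- p - d) / (2 * c)))).
    by rewrite prod mulrN1.
  by field.
split=> [/eqP|[]->]; last 2 first.
- by rewrite subrr mul0r mulr0.
- by rewrite subrr !mulr0.
rewrite mulf_eq0 (negbTE cN0) /= mulf_eq0 !subr_eq0.
by case/orP => /eqP; [left|right].
Qed.

Theorem theorem3 (R : realType) (I : set R)
    (alpha T N B1 B2 : R -> 'rV[R]_4) (k2 k3 : R -> R)
    (Hcurve : null_cartan_curve I alpha T N B1 B2 k2 k3)
    (Hk3 : exists s, I s /\ k3 s != 0) :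
  let V := frame_field T N B1 in
  let cond_i := null_cartan_helix I k2 k3 in
  let sat_ii := unit_axis_field I T N B1 k2 k3 in
  let cond_ii := exists lambda0 mu0 nu0 : R, sat_ii lambda0 mu0 nu0 in
  (cond_i <-> cond_ii) /\
  (cond_i \/ cond_ii ->
   exists r1 r2 l1 m1 n1 l2 m2 n2 : R,
     [/\ r1 != r2,
         forall s, I s -> forall r,
           curvature_quadratic k2 k3 s r = 0 <-> r = r1 \/ r = r2 &
         r1 * r2 = -1] /\
     [/\ sat_ii l1 m1 n1, sat_ii l2 m2 n2, m1 / n1 = r1 & m2 / n2 = r2] /\
     [/\ ~ eq_up_to_sign I (V l1 m1 n1) (V l2 m2 n2),
         forall l m n, sat_ii l m n ->
           eq_up_to_sign I (V l m n) (V l1 m1 n1) \/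
           eq_up_to_sign I (V l m n) (V l2 m2 n2) &
         forall s, I s -> mink (V l1 m1 n1 s) (V l2 m2 n2 s) = 0]).
Proof.
move=> V cond_i sat_ii cond_ii.
have assemble (A B C : Prop) :
    (B -> A) -> (A -> C) -> (C -> B) -> (A <-> B) /\ (A \/ B -> C) by tauto.
apply: assemble.
  by case=> [l [m [n]]]; apply: (unit_axis_field_helix Hcurve Hk3).
all: swap 1 2.
  by case=> [_ [_ [l [m [n [_ [_ [_ [_ [[? _ _ _] _]]]]]]]]]]; exists l, m, n.
move=> [c2 [c3 [c3N0 kE]]].
have k2E s (Is : I s) : k2 s = c2 := (kE s Is).1.
have k3E s (Is : I s) : k3 s = c3 := (kE s Is).2.
have [r1 [r2 [r12 prod rootE]]] :=
  quadratic_roots_product_m1 (c2 ^+ 2) c3N0.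
have [s0 Is0] := curve_domain_nonempty Hcurve.
have norm_pos (r : R) : 0 < 1 + r ^+ 2 by rewrite ltr_pwDl // sqr_ge0.
pose nu (r : R) := (Num.sqrt (1 + r ^+ 2))^-1.
have nuE r : nu r ^+ 2 * (1 + r ^+ 2) = 1.
  by rewrite /nu exprVn sqr_sqrtr ?(ltW (norm_pos r)) // mulVf // gt_eqF.
have nuN0 r : nu r != 0 by rewrite invr_eq0 gt_eqF // sqrtr_gt0.
have root1 := (rootE r1).2 (or_introl erefl).
have root2 := (rootE r2).2 (or_intror erefl).
have sat1 : sat_ii (nu r1 * c2) (r1 * nu r1) (nu r1).
  exact (helix_unit_axis_field Hcurve k2E k3E prod root1 root2 (nuE r1)).
have sat2 : sat_ii (nu r2 * c2) (r2 * nu r2) (nu r2).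
  apply: (helix_unit_axis_field Hcurve k2E k3E _ root2 root1 (nuE r2)).
  by rewrite mulrC.
have orth s : I s -> mink (V (nu r1 * c2) (r1 * nu r1) (nu r1) s)
                          (V (nu r2 * c2) (r2 * nu r2) (nu r2) s) = 0.
  move=> Is; rewrite (mink_frame_field Hcurve) //.
  by rewrite mulrACA prod mulN1r addNr.
exists r1, r2, (nu r1 * c2), (r1 * nu r1), (nu r1).
exists (nu r2 * c2), (r2 * nu r2), (nu r2).
split; first by split=> // s Is r; rewrite /curvature_quadratic k2E // k3E.
split; first by split=> //; rewrite mulfK.
split=> //.
- have V1 : mink (V (nu r1 * c2) (r1 * nu r1) (nu r1) s0)
                 (V (nu r1 * c2) (r1 * nu r1) (nu r1) s0) = 1.
    by rewrite (mink_frame_field Hcurve) // -(nuE r1); ring.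
  have O := orth s0 Is0.
  case=> /(_ s0 Is0) E.
  + by move: O; rewrite -E V1 => /eqP; rewrite oner_eq0.
  + move: V1; rewrite {2}E minkNr O oppr0 => /eqP.
    by rewrite eq_sym oner_eq0.
- move=> l m n sat.
  have rmn : m / n = r1 \/ m / n = r2.
    case: sat => _ _ _ /(_ s0 Is0) + _.
    by rewrite /curvature_quadratic k2E // k3E // => /rootE.
  by case: rmn => rE; [left|right]; apply: (unit_axis_field_unique sat) => //;
    rewrite mulfK.
Qed.
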